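(* Let $\Phi:\mathbb{R}^d\to\mathbb{R}$ and $\Psi:\mathbb{R}^s\to\mathbb{R}$ be both conditionally positive definite functions of order $1$ (or both conditionally negative definite functions of order $1$). For any pair of graphs with (symmetric) affinity matrices $A,B\in\mathbb{R}^{n\times n}$ such that $$A_{ij}=\Phi(x_i-x_j),\qquad B_{ij}=\Psi(y_i-y_j),\qquad i,j\in\{1,\dots,n\},$$ for some arbitrary $x_1,\dots,x_n\in\mathbb{R}^d$ and $y_1,\dots,y_n\in\mathbb{R}^s$, the energy $E_2(X)=-\mathrm{tr}(BX^TAX)$, $X\in\mathbb{R}^{n\times n}$, is conditionally concave, i.e. its Hessian $M=-(B\otimes A)$ satisfies $M|_{\mathrm{lin}(\mathrm{DS})}\prec 0$.
   Context: For $X\in\mathbb{R}^{n\times n}$, $[X]\in\mathbb{R}^{n^2}$ denotes its column stack (the columns of $X$ stacked one below the other). $\otimes$ is the Kronecker product, so for symmetric $A,B$ one has $E_2(X)=[X]^TM[X]$ with $M=-(B\otimes A)$; the matrix $M$ of the quadratic form is called the Hessian (positive scalar factors are ignored). $\mathbf 1$ is the all-ones vector. $\mathrm{lin}(\mathrm{DS})=\{X\in\mathbb{R}^{n\times n} : X\mathbf 1=0,\ X^T\mathbf 1=0\}$ is the linear part of the affine hull of the set $\mathrm{DS}$ of doubly stochastic $n\times n$ matrices. $M|_{\mathrm{lin}(\mathrm{DS})}\prec 0$ means that $[X]^TM[X]<0$ for every $0\neq X\in\mathrm{lin}(\mathrm{DS})$. A function $\Phi:\mathbb{R}^d\to\mathbb{R}$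 is conditionally positive definite of order $m$ if for all pairwise distinct points $x_1,\dots,x_n\in\mathbb{R}^d$ and all $0\neq\eta\in\mathbb{R}^n$ satisfying $\sum_{i}\eta_i p(x_i)=0$ for all $d$-variate polynomials $p$ of degree less than $m$, one has $\sum_{i,j=1}^n\eta_i\bar\eta_j\Phi(x_i-x_j)>0$. In particular, for order $1$ the condition on $\eta$ is $\sum_i\eta_i=0$. Conditionally negative definite is defined analogously.
   Formalization: The points x_1,…,x_n are assumed pairwise distinct, and likewise y_1,…,y_n, instead of arbitrary; if two coincide (n ≥ 2), some nonzero X in lin(DS) has E_2(X)=0, so the strict claim fails. *)

(* Defs.v *)
From HB Require Import structures.
From mathcomp Require Import all_boot all_order all_algebra.
From mathcomp Require Import reals.
From mathcomp.real_closed Require Export mxtens.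
From mathcomp.multinomials Require Import mpoly.

Set Implicit Arguments.
Unset Strict Implicit.
Unset Printing Implicit Defensive.

Import Order.TTheory GRing.Theory Num.Theory.
Local Open Scope ring_scope.

(* [msize p] is the total degree plus one (and 0 for p = 0), so
   [msize p <= m] says that p has degree less than m. *)
Definition annihilates_polys (R : realType) (m d n : nat)
    (x : 'I_n -> 'rV[R]_d) (eta : 'cV[R]_n) : Prop :=
  forall p : {mpoly R[d]}, (msize p <= m)%N ->
    \sum_i eta i 0 * p.@[x i 0] = 0.

Definition cond_pos_def (R : realType) (m d : nat)
    (Phi : 'rV[R]_d -> R) : Prop :=
  forall (n : nat) (x : 'I_n -> 'rV[R]_d) (eta : 'cV[R]_n),
    injective x -> eta != 0 -> annihilates_polys m x eta ->
    0 < \sum_i \sum_j eta i 0 * eta j 0 * Phi (x i - x j).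

Definition cond_neg_def (R : realType) (m d : nat)
    (Phi : 'rV[R]_d -> R) : Prop :=
  forall (n : nat) (x : 'I_n -> 'rV[R]_d) (eta : 'cV[R]_n),
    injective x -> eta != 0 -> annihilates_polys m x eta ->
    \sum_i \sum_j eta i 0 * eta j 0 * Phi (x i - x j) < 0.

(* [mxtens_unindex k] is (k %/ n, k %% n): entry j * n + i of the stack is
   X i j.  This is the index order of the Kronecker product [*t].  (The
   library's [mxvec] stacks rows.) *)
Definition colstack (R : realType) (n : nat) (X : 'M[R]_n) : 'cV[R]_(n * n) :=
  \col_k X (mxtens_unindex k).2 (mxtens_unindex k).1.

Definition quad_form (R : realType) (n : nat) (M : 'M[R]_(n * n))
    (X : 'M[R]_n) : R :=
  ((colstack X)^T *m M *m colstack X) 0 0.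

Definition E2 (R : realType) (n : nat) (A B X : 'M[R]_n) : R :=
  - \tr (B *m X^T *m A *m X).

(* The Hessian is taken up to a positive factor: the analytic Hessian of
   X |-> [X]^T M [X] with M symmetric is 2 M. *)
Definition is_hessian (R : realType) (n : nat) (E : 'M[R]_n -> R)
    (M : 'M[R]_(n * n)) : Prop :=
  M^T = M /\ forall X : 'M[R]_n, E X = quad_form M X.

Definition lin_DS (R : realType) (n : nat) (X : 'M[R]_n) : Prop :=
  X *m const_mx 1 = 0 :> 'cV[R]_n /\ X^T *m const_mx 1 = 0 :> 'cV[R]_n.

Definition neg_def_on_lin_DS (R : realType) (n : nat)
    (M : 'M[R]_(n * n)) : Prop :=
  forall X : 'M[R]_n, X != 0 -> lin_DS X -> quad_form M X < 0.

(* Main.v *)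
(* With C = X^T A X one has -E_2(X) = tr(B C), where C is nonzero, positive
   semidefinite and kills the all-ones vector.  Eliminating one pivot at a
   time writes C as a sum of matrices a^-1 c c^T with a > 0, where each c is
   a column of a matrix killing the all-ones vector and so has coordinate sum
   0; each of them contributes a^-1 c^T B c > 0 to the trace. *)
Require Import Defs.
From mathcomp Require Import all_boot all_order all_algebra.
From mathcomp Require Import reals.
From mathcomp Require Import ring lra.
From mathcomp.multinomials Require Import mpoly.

Set Implicit Arguments.
Unset Strict Implicit.
Unset Printing Implicit Defensive.

Import Order.TTheory GRing.Theory Num.Theory.
Local Open Scope ring_scope.

Definition qform (R : realFieldType) (n : nat) (M : 'M[R]_n) (v : 'cV[R]_n) : R :=
  (v^T *m M *m v) 0 0.

Definition psd (R : realFieldType) (n : nat) (C : 'M[R]_n) : Prop :=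
  forall v : 'cV[R]_n, 0 <= qform C v.

Definition pos_on_sum0 (R : realFieldType) (n : nat) (B : 'M[R]_n) : Prop :=
  forall v : 'cV[R]_n, v != 0 -> v^T *m (const_mx 1 : 'cV_n) = 0 -> 0 < qform B v.

Lemma qformE (R : realFieldType) (n : nat) (M : 'M[R]_n) (v : 'cV[R]_n) :
  qform M v = \sum_i \sum_j v i 0 * v j 0 * M i j.
Proof.
rewrite /qform mxE exchange_big; apply: eq_bigr => j _ /=.
rewrite mxE big_distrl; apply: eq_bigr => i _ /=.
by rewrite !mxE mulrAC.
Qed.

Lemma trmx11E (T : Type) (M : 'M[T]_1) : M 0 0 = M^T 0 0.
Proof. by rewrite mxE. Qed.

(** As a quadratic in [t] along one coordinate axis, this serves both to detect a negative value and
    to complete the square. *)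
Lemma qform_shift (R : realFieldType) (n : nat) (C : 'M[R]_n) (v : 'cV[R]_n)
    (j : 'I_n) (t : R) (symC : C^T = C) :
  qform C (v + t *: delta_mx j 0)
  = qform C v + t * (C *m v) j 0 *+ 2 + t ^+ 2 * C j j.
Proof.
have e w : ((delta_mx j 0 : 'cV[R]_n)^T *m w : 'M_1) 0 0 = w j 0.
  by rewrite trmx_delta -rowE mxE.
have f : (v^T *m C *m (delta_mx j 0 : 'cV[R]_n)) 0 0 = (C *m v) j 0.
  by rewrite trmx11E trmx_mul trmx_mul trmxK symC e.
rewrite /qform [(_ + _)^T]linearD /= [(t *: _)^T]linearZ /= !mulmxDl !mulmxDr.
rewrite -!scalemxAl -!scalemxAr.
rewrite ![((_ + _) : 'M_1) _ _]mxE ![((_ *: _) : 'M_1) _ _]mxE f.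
rewrite -!mulmxA !e -colE [col j C j 0]mxE.
by ring.
Qed.

Lemma qform_delta (R : realFieldType) (n : nat) (C : 'M[R]_n) (j : 'I_n) :
  qform C (delta_mx j 0) = C j j.
Proof. by rewrite /qform -mulmxA trmx_delta -rowE mxE -colE mxE. Qed.

Lemma psd_diag0 (R : realFieldType) (n : nat) (C : 'M[R]_n) (symC : C^T = C) :
  psd C -> (forall i, C i i = 0) -> C = 0.
Proof.
move=> psdC diag0; apply/matrixP => i j; rewrite [RHS]mxE.
(* With a zero diagonal the form at [e_j + t e_i] is [2 t C i j]; taking [t = - C i j] gives
   [- 2 (C i j)^2], which must be nonnegative. *)
have := psdC (delta_mx j 0 + - C i j *: delta_mx i 0).
rewrite qform_shift // qform_delta !diag0 -colE mxE => h.
by apply/eqP; rewrite -sqrf_eq0; apply/eqP; have := sqr_ge0 (C i j); nra.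
Qed.

(** For symmetric [C] with [C j j != 0], this is the Schur complement of the entry [C j j], bordered
    by a zero row and column at [j]. *)
Definition pivot (R : realFieldType) (n : nat) (C : 'M[R]_n) (j : 'I_n) : 'M[R]_n :=
  C - (C j j)^-1 *: (col j C *m (col j C)^T).

(** Completing the square: the new form at [v] is the minimum over [t] of the old one at
    [v + t e_j], attained at [t = - (C v)_j / C j j]. *)
Lemma psd_pivot (R : realFieldType) (n : nat) (C : 'M[R]_n) (j : 'I_n)
    (symC : C^T = C) (Cjj : C j j != 0) : psd C -> psd (pivot C j).
Proof.
move=> psdC v; set t := - ((C j j)^-1 * (C *m v) j 0).
have f : ((col j C)^T *m v) 0 0 = (C *m v) j 0.
  by rewrite tr_col symC -row_mul mxE.
have g : (v^T *m col j C) 0 0 = (C *m v) j 0.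
  by rewrite -f trmx11E trmx_mul trmxK.
suff -> : qform (pivot C j) v = qform C (v + t *: delta_mx j 0) by [].
rewrite qform_shift // /qform /pivot mulmxBr mulmxBl mxE [X in _ + X]mxE.
have h : (v^T *m (col j C *m (col j C)^T) *m v) 0 0 = (C *m v) j 0 ^+ 2.
  by rewrite mulmxA -mulmxA mxE big_ord1 f g.
rewrite -scalemxAr -scalemxAl [X in _ - X]mxE h /t.
by field.
Qed.

Lemma trace_mul_psd_gt0 (R : realFieldType) (n : nat) (B C : 'M[R]_n)
    (posB : pos_on_sum0 B) (symC : C^T = C) (C1 : C *m (const_mx 1 : 'cV_n) = 0) :
  psd C -> C != 0 -> 0 < \tr (B *m C).
Proof.
(* Strong induction on the number of nonzero diagonal entries. *)
elim: {C}_.+1 {-2}C (ltnSn #|[set i | C i i != 0]|) symC C1 => // m IHm C.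
rewrite ltnS => leC symC C1 psdC CN0.
have [j Cjj|diag0] := pickP (fun j => C j j != 0); last first.
  case/eqP: CN0; apply: psd_diag0 => // i.
  by apply/eqP; have /negbFE := diag0 i.
have Cgt0 : 0 < C j j by rewrite lt0r Cjj -qform_delta psdC.
have c1 : (col j C)^T *m (const_mx 1 : 'cV_n) = 0.
  by rewrite tr_col symC -row_mul C1 row0.
have cN0 : col j C != 0.
  by apply: contraNneq Cjj => /matrixP/(_ j 0); rewrite !mxE => ->.
have psdP := psd_pivot symC Cjj psdC.
have symP : (pivot C j)^T = pivot C j.
  by rewrite /pivot linearB linearZ /= trmx_mul trmxK symC.
have P1 : pivot C j *m (const_mx 1 : 'cV_n) = 0.
  by rewrite /pivot mulmxBl C1 -scalemxAl -mulmxA c1 mulmx0 scaler0 subr0.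
have diagP i : pivot C j i i = C i i - (C j j)^-1 * C i j ^+ 2.
  by rewrite !mxE big_ord1 !mxE.
have ltP : (#|[set i | pivot C j i i != 0%R]| < m)%N.
  (* Entry [j] of the diagonal becomes zero, and no zero entry is lost: where [C i i = 0] the new
     entry is a negated square over [C j j], hence at most 0, yet nonnegative by [psdP]. *)
  apply: leq_trans leC; apply: proper_card; apply/properP; split.
    apply/subsetP => i; rewrite !inE; apply: contraNN => /eqP Cii.
    have := psdP (delta_mx i 0 : 'cV_n); rewrite qform_delta eq_le => ->.
    by rewrite andbT diagP Cii sub0r oppr_le0 mulr_ge0 ?sqr_ge0 ?invr_ge0 ?ltW.
  exists j; rewrite !inE ?Cjj // diagP expr2 mulKf //.
  by rewrite subrr eqxx.
(* The remainder may vanish, so strictness has to come from the rank-one term. *)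
have P_ge0 : 0 <= \tr (B *m pivot C j).
  have [->|PN0] := eqVneq (pivot C j) 0; first by rewrite mulmx0 mxtrace0.
  exact/ltW/IHm.
have -> : C = pivot C j + (C j j)^-1 *: (col j C *m (col j C)^T).
  by rewrite subrK.
rewrite mulmxDr linearD /= ltr_wpDl // -scalemxAr linearZ /=.
rewrite mulr_gt0 ?invr_gt0 // mulmxA mxtrace_mulC mulmxA.
by rewrite /mxtrace big_ord1 posB.
Qed.

(** The two conditions on [X] act separately: [X^T 1 = 0] puts every [X v] where [A] is positive,
    while [X 1 = 0] makes [X^T A X] kill the all-ones vector. *)
Lemma trace_congr_gt0 (R : realFieldType) (n : nat) (A B X : 'M[R]_n)
    (symA : A^T = A) (posA : pos_on_sum0 A) (posB : pos_on_sum0 B) :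
  X != 0 -> X *m (const_mx 1 : 'cV_n) = 0 -> X^T *m (const_mx 1 : 'cV_n) = 0 ->
  0 < \tr (B *m (X^T *m A *m X)).
Proof.
move=> XN0 X1 XT1.
have qC v : qform (X^T *m A *m X) v = qform A (X *m v).
  by rewrite /qform trmx_mul !mulmxA.
have Xv1 (v : 'cV_n) : (X *m v)^T *m (const_mx 1 : 'cV[R]_n) = 0.
  by rewrite trmx_mul -mulmxA XT1 mulmx0.
apply: (trace_mul_psd_gt0 posB).
- by rewrite !trmx_mul trmxK symA mulmxA.
- by rewrite -mulmxA X1 mulmx0.
- move=> v; rewrite qC; have [->|XvN0] := eqVneq (X *m v) 0.
    by rewrite /qform mulmx0 mxE.
  exact/ltW/posA.
(* If [X^T A X = 0], the form of [A] vanishes at each column of [X], a vector of sum 0, so every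
   column is zero. *)
apply: contraNneq XN0 => C0; apply/eqP/matrixP => i j; rewrite [RHS]mxE.
have -> : X i j = (X *m (delta_mx j 0 : 'cV[R]_n)) i 0 by rewrite -colE mxE.
have [->|XjN0] := eqVneq (X *m (delta_mx j 0 : 'cV[R]_n)) 0; first by rewrite mxE.
have := posA _ XjN0 (Xv1 _).
by rewrite -qC C0 qform_delta mxE ltxx.
Qed.

Lemma sum_mxtens (V : nmodType) (m n : nat) (F : 'I_(m * n) -> V) :
  \sum_k F k = \sum_i \sum_j F (mxtens_index (i, j)).
Proof.
rewrite pair_bigA; apply: reindex.
exists (@mxtens_unindex m n) => [[i j]|k] _; first exact: mxtens_indexK.
by rewrite -surjective_pairing mxtens_unindexK.
Qed.

Lemma colstack_dot (R : realType) (n : nat) (X Y : 'M[R]_n) :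
  ((colstack X)^T *m colstack Y) 0 0 = \tr (X^T *m Y).
Proof.
rewrite mxE sum_mxtens; apply: eq_bigr => i _.
by rewrite mxE; apply: eq_bigr => j _; rewrite !mxE mxtens_indexK.
Qed.

Lemma tens_colstack (R : realType) (n : nat) (A B X : 'M[R]_n) :
  (B *t A) *m colstack X = colstack (A *m X *m B^T).
Proof.
apply/matrixP => k z; rewrite !mxE sum_mxtens; apply: eq_bigr => i _.
rewrite mxE big_distrl; apply: eq_bigr => j _ /=.
by rewrite !mxE mxtens_indexK -mulrA mulrC.
Qed.

Lemma quad_form_tens (R : realType) (n : nat) (A B X : 'M[R]_n) (symB : B^T = B) :
  quad_form (- (B *t A)) X = E2 A B X.
Proof.
rewrite /quad_form /E2 mulmxN mulNmx mxE -mulmxA tens_colstack colstack_dot symB.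
by rewrite !mulmxA mxtrace_mulC !mulmxA.
Qed.

Lemma cond_neg_defN (R : realType) (m d : nat) (Phi : 'rV[R]_d -> R) :
  cond_neg_def m Phi -> cond_pos_def m (fun z => - Phi z).
Proof.
move=> neg n x eta inj_x etaN0 ann; rewrite -oppr_lt0 -sumrN.
under eq_bigr do (rewrite -sumrN; under eq_bigr do rewrite mulrN opprK).
exact: neg.
Qed.

Lemma cond_pos_def_pos_on_sum0 (R : realType) (d n : nat) (Phi : 'rV[R]_d -> R)
    (A : 'M[R]_n) (x : 'I_n -> 'rV[R]_d) (inj_x : injective x)
    (hA : forall i j, A i j = Phi (x i - x j)) :
  cond_pos_def 1 Phi -> pos_on_sum0 A.
Proof.
move=> pos v vN0 v1; rewrite qformE.
under eq_bigr do under eq_bigr do rewrite hA.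
(* At order 1 the test polynomials are constants, so annihilation amounts to coordinate sum 0. *)
apply: pos => // p /msize1_polyC ->.
under eq_bigr do rewrite mevalC.
have /matrixP/(_ 0 0) := v1; rewrite !mxE => v1E.
rewrite -mulr_suml -[RHS](mul0r p@_0) -[in RHS]v1E; congr (_ * _).
by apply: eq_bigr => i _; rewrite !mxE mulr1.
Qed.

Unset Implicit Arguments.

(** The points are taken distinct: if all [x i] coincide, [A] is a constant matrix and [X^T A X = 0]
    on lin(DS), so strict negativity fails for [n >= 2]. *)
Theorem theorem1 (R : realType) (d s : nat)
    (Phi : 'rV[R]_d -> R) (Psi : 'rV[R]_s -> R)
    (hPhiPsi : (cond_pos_def 1 Phi /\ cond_pos_def 1 Psi) \/
               (cond_neg_def 1 Phi /\ cond_neg_def 1 Psi))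
    (n : nat) (A B : 'M[R]_n)
    (symA : A^T = A) (symB : B^T = B)
    (x : 'I_n -> 'rV[R]_d) (y : 'I_n -> 'rV[R]_s)
    (x_distinct : injective x) (y_distinct : injective y)
    (hA : forall i j : 'I_n, A i j = Phi (x i - x j))
    (hB : forall i j : 'I_n, B i j = Psi (y i - y j)) :
  is_hessian (E2 A B) (- (B *t A)) /\ neg_def_on_lin_DS (- (B *t A)).
Proof.
split.
  split=> [|X]; last by rewrite quad_form_tens.
  by rewrite linearN /= trmx_tens symA symB.
move=> X XN0 [X1 XT1]; rewrite quad_form_tens // /E2 oppr_lt0.
rewrite -!mulmxA [X^T *m _]mulmxA.
case: hPhiPsi => -[hPhi hPsi].
  apply: trace_congr_gt0 => //.
    exact: cond_pos_def_pos_on_sum0 x_distinct hA hPhi.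
  exact: cond_pos_def_pos_on_sum0 y_distinct hB hPsi.
(* Flipping both signs leaves the product unchanged and reduces the negative case to the positive
   one. *)
have -> : B *m (X^T *m A *m X) = - B *m (X^T *m - A *m X).
  by rewrite mulmxN !mulNmx mulmxN opprK.
apply: trace_congr_gt0 => //; first by rewrite linearN /= symA.
  apply: cond_pos_def_pos_on_sum0 x_distinct _ (cond_neg_defN hPhi) => i j.
  by rewrite mxE hA.
apply: cond_pos_def_pos_on_sum0 y_distinct _ (cond_neg_defN hPsi) => i j.
by rewrite mxE hB.
Qed.
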